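(* Let $k\ge 6$ be an even integer. Then the generalized Bethe tree $\mathcal{B}(5,k-3,5,3,\underbrace{2,2,\ldots,2}_{k-5})$, which has $k$ levels, has at most $k-1$ main eigenvalues.
   Context: All graphs are simple. For a graph $G$ on vertex set $\{1,\ldots,n\}$, the adjacency matrix $A(G)=(a_{ij})$ is the $n\times n$ matrix with $a_{ij}=1$ if $i,j$ are adjacent and $a_{ij}=0$ otherwise; eigenvalues and eigenspaces of $G$ are those of $A(G)$. An eigenvalue of $G$ is a main eigenvalue if its eigenspace is not orthogonal to the all-ones vector $e_n$; the number of main eigenvalues counts distinct eigenvalues. Given $k\ge 2$ and integers $d_1,\ldots,d_{k-1}\ge 2$, the generalized Bethe tree $\mathcal{B}(d_1,\ldots,d_{k-1})$ with $k$ levels is the rooted tree whose vertices are arranged in levels $1,\ldots,k$ (level $1$ consisting of the root only, level $k$ consisting of the leaves), in which every vertex at level $i$ has degree $d_i$ for $i=1,\ldots,k-1$ (so the root has $d_1$ children and each vertex at level $i$ with $2\le i\le k-1$ has $d_i-1$ children at level $i+1$). *)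

(* Defs.v *)
From HB Require Import structures.
From mathcomp Require Import all_boot all_order all_algebra.
From mathcomp Require Import classical_sets cardinality reals.

Set Implicit Arguments.
Unset Strict Implicit.
Unset Printing Implicit Defensive.

Import Order.TTheory GRing.Theory Num.Theory.
Local Open Scope ring_scope.

(* A graph is given by its adjacency relation [e] on a finite vertex type. *)

Definition simple_graph (T : finType) (e : rel T) : Prop :=
  symmetric e /\ irreflexive e.

Definition degree (T : finType) (e : rel T) (x : T) : nat :=
  #|[set y | e x y]%SET|.

(* [ucycle e c] already holds for an edge traversed back and forth, which is
   not a graph cycle; cycles have at least three vertices. *)
Definition tree (T : finType) (e : rel T) : Prop :=
  [/\ simple_graph e,
      (forall x y : T, connect e x y) &
      (forall c : seq T, ucycle e c -> (size c < 3)%N)].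

(* Least length of a walk from [x] to [y]; the junk value #|T| is returned
   when there is none, which does not happen in a connected graph. *)
Definition dist (T : finType) (e : rel T) (x y : T) : nat :=
  find (fun m => [exists p : m.-tuple T, path e x p && (last x p == y)])
       (iota 0 #|T|).

Definition level (T : finType) (e : rel T) (r x : T) : nat :=
  (dist e r x).+1.

(* [gen_bethe_tree ds e r]: the graph [e], rooted at [r], is (a copy of)
   B(d_1, ..., d_{k-1}) where ds = [:: d_1; ...; d_{k-1}], so that
   k = (size ds).+1; d_i is stored at index i.-1 of [ds]. *)
Definition gen_bethe_tree (ds : seq nat) (T : finType) (e : rel T) (r : T)
    : Prop :=
  let k := (size ds).+1 in
  [/\ (2 <= k)%N /\ all (leq 2) ds,
      tree e,
      (forall x : T, (level e r x <= k)%N),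
      (forall x : T, (level e r x < k)%N ->
         degree e x = nth 0%N ds (level e r x).-1) &
      (forall x : T, level e r x = k -> degree e x = 1%N)].

Definition adjacency_matrix (R : realType) (n : nat) (e : rel 'I_n) : 'M[R]_n :=
  \matrix_(i, j) (e i j)%:R.

(* The rows of [eigenspace A a] span the eigenspace of [a], so the product
   vanishes iff the whole eigenspace is orthogonal to the all-ones vector. *)
Definition main_eigenvalue (R : realType) (n : nat) (e : rel 'I_n) (a : R)
    : bool :=
  let A := adjacency_matrix R e in
  eigenvalue A a && (eigenspace A a *m (const_mx 1 : 'cV[R]_n) != 0).

(* Main.v *)
Require Import Defs.
From HB Require Import structures.
From mathcomp Require Import all_boot all_order all_algebra.
From mathcomp Require Import classical_sets cardinality reals.
From mathcomp Require Import finmap boolp zify ring.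

Set Implicit Arguments.
Unset Strict Implicit.
Unset Printing Implicit Defensive.

Import Order.TTheory GRing.Theory Num.Theory.
Local Open Scope ring_scope.

(** The partition of a generalized Bethe tree by levels is equitable, so with
    [L] the level indicator matrix and [B] the quotient matrix, [A L = L B].
    Hence every main eigenvalue of the tree is an eigenvalue of [B], which has
    at most [k] of them.  For the tree at hand [-2] is an eigenvalue of [B],
    with the eigenvector [bethe_eigenfun]; but it is not main, because the
    all-ones vector lies in the image of [A + 2]: it is the image of half the
    level function [bethe_preimage]. *)

(** * Distance from the root *)

Section Distance.
Variables (T : finType) (e : rel T) (r : T).
Hypothesis e_conn : forall x y : T, connect e x y.

Lemma dist_le (x : T) (p : seq T) :
  path e r p -> last r p = x -> (dist e r x <= size p)%N.
Proof.
move=> ep lp; rewrite /dist; set P := (X in find X _).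
have Pp : P (size p).
  by apply/existsP; exists (in_tuple p); rewrite /= ep lp eqxx.
case: (ltnP (size p) #|T|) => [pT|]; last first.
  (* [find] never exceeds the length [#|T|] of the searched list, so a walk that is too long to be
     found still satisfies the bound. *)
  by apply: leq_trans; rewrite (leq_trans (find_size _ _)) ?size_iota.
rewrite leqNgt; apply/negP => /(before_find 0%N).
by rewrite nth_iota // add0n Pp.
Qed.

Lemma dist_walk (x : T) :
  exists p, [/\ path e r p, last r p = x & size p = dist e r x].
Proof.
rewrite /dist; set P := (X in find X _).
have hasP : has P (iota 0 #|T|).
  have /connectP[q] := e_conn r x.
  (* A path without repeated vertices has length below [#|T|], hence within the range of the
     search. *)
  case/shortenP => p ep up _ lx.
  apply/hasP; exists (size p).
    by rewrite mem_iota /= add0n (leq_trans _ (max_card (mem (r :: p)))) //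
      (card_uniqP up).
  by apply/existsP; exists (in_tuple p); rewrite /= ep lx eqxx.
have := nth_find 0%N hasP; rewrite nth_iota; last first.
  by rewrite -[X in (_ < X)%N](size_iota 0) -has_find.
rewrite add0n => /existsP[p /andP[ep /eqP lp]].
by exists p; rewrite size_tuple.
Qed.

Lemma dist_root : dist e r r = 0%N.
Proof. by apply/eqP; rewrite -leqn0; apply: (@dist_le r [::]). Qed.

Lemma dist_eq0 (x : T) : (dist e r x == 0%N) = (x == r).
Proof.
apply/eqP/eqP => [d0|->]; last exact: dist_root.
have [p [_ lp]] := dist_walk x.
by rewrite d0 => /size0nil p0; rewrite -lp p0.
Qed.

Lemma dist_edge (x y : T) : e x y -> (dist e r y <= (dist e r x).+1)%N.
Proof.
move=> exy; have [p [ep lp <-]] := dist_walk x.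
by rewrite -(size_rcons p y); apply: dist_le;
  rewrite ?rcons_path ?last_rcons ?ep ?lp.
Qed.

(** The witness is the vertex before [x] on a shortest walk from the root. *)
Lemma dist_parent (x : T) :
  x != r -> exists2 y, e y x & dist e r x = (dist e r y).+1.
Proof.
have [p] := dist_walk x; case/lastP: p => [|p z] [ep lp sp].
  by rewrite -lp eqxx.
move: ep lp sp; rewrite rcons_path last_rcons size_rcons.
move=> /andP[ep ez] zx sp _.
rewrite zx in ez; exists (last r p) => //; apply/eqP.
by rewrite eqn_leq dist_edge //= -sp ltnS dist_le.
Qed.

End Distance.

(** * Levels of the neighbours of a vertex in a tree *)

Section TreeLevels.
Variables (T : finType) (e : rel T) (r : T).
Hypothesis e_tree : tree e.

Let e_sym : symmetric e. Proof. by case: e_tree => -[]. Qed.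
Let e_irr : irreflexive e. Proof. by case: e_tree => -[]. Qed.
Let e_conn : forall x y, connect e x y. Proof. by case: e_tree. Qed.

(* Two such neighbours would be joined by a path through the root that avoids
   [x], since a shortest path to either of them does; this closes a cycle. *)
Lemma tree_lower_neighbour_unique (x y z : T) :
  e x y -> e x z ->
  (dist e r y <= dist e r x)%N -> (dist e r z <= dist e r x)%N -> y = z.
Proof.
move=> exy exz dy dz; apply/eqP/negPn/negP => yz.
(* This is the graph with [x] deleted. *)
pose e' := [rel a b | [&& e a b, a != x & b != x]].
have e'_sym : connect_sym e'.
  by apply: sym_connect_sym => a b; rewrite /= e_sym andbCA andbC -andbA andbCA.
(* Each step to a parent goes strictly below the level of [x], so the descent to the root never
   meets [x]. *)
have to_root : forall m a, dist e r a = m ->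
    (m <= dist e r x)%N -> a != x -> connect e' r a.
  elim=> [|m IHm] a da mx ax.
    by move/eqP: da; rewrite dist_eq0 // => /eqP ->; apply: connect0.
  have ar : a != r by rewrite -(dist_eq0 r e_conn) da.
  have [b eba] := dist_parent e_conn ar; rewrite da => -[db].
  have bx : b != x by apply: contraTneq mx => <-; rewrite -db ltnn.
  apply: connect_trans (IHm _ _ (ltnW mx) bx) _ => //.
  by apply: connect1; rewrite /= eba bx ax.
have neq w : e x w -> w != x by apply: contraTneq => ->; rewrite e_irr.
have : connect e' y z.
  apply: connect_trans (to_root _ _ (erefl _) dz (neq _ exz)).
  by rewrite e'_sym; apply: to_root (neq _ exy).
case/connectP => q; case/shortenP => p e'p up _ lz.
have p0 : (0 < size p)%N.
  by case: (p) lz => //= zy; rewrite zy eqxx in yz.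
have ep : path e y p by apply: sub_path e'p => a b /= /and3P[].
have xp : x \notin y :: p.
  rewrite inE negb_or eq_sym neq //=.
  elim: (p) (y) e'p => //= a s IHs b /andP[/and3P[_ _ ax] /IHs].
  by rewrite inE negb_or eq_sym ax.
(* The edge between [z] and [x] closes the cycle; [p] is nonempty because [y != z], so there are at
   least three vertices. *)
have [_ _ /(_ (x :: y :: p))] := e_tree.
rewrite /ucycle /= exy rcons_path ep -lz e_sym exz.
move: up xp => /= -> -> /(_ isT).
by rewrite !ltnS leqNgt p0.
Qed.

(** A non-root vertex has one parent, and by uniqueness all its other neighbours lie one level
    further from the root. For the root, the factor [(x != r)%:R] removes the meaningless parent
    term. *)
Lemma tree_level_sum (V : comPzRingType) (f : nat -> V) (x : T) :
  \sum_(y | e x y) f (dist e r y) =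
    (x != r)%:R * f (dist e r x).-1
    + (degree e x - (x != r))%:R * f (dist e r x).+1.
Proof.
have deg : \sum_(y | e x y) 1%N = degree e x.
  by rewrite sum1_card /degree; apply: eq_card => y; rewrite !inE.
case: (eqVneq x r) => [xr|xr] /=.
  rewrite mul0r add0r subn0 -deg -[X in _ = X * _]/(_%:R) natr_sum mulr_suml.
  apply: eq_bigr => y exy; rewrite mul1r; congr f.
  have := dist_edge r e_conn exy; rewrite xr dist_root.
  rewrite leq_eqVlt ltnS leqn0 dist_eq0 // => /orP[/eqP //|/eqP yr].
  by move: exy; rewrite xr yr e_irr.
have [z ezx dx] := dist_parent e_conn xr.
have exz : e x z by rewrite e_sym.
rewrite (bigD1 z) //= mul1r dx; congr (_ + _).
have -> : (degree e x - 1)%N = \sum_(y | e x y && (y != z)) 1%N.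
  by rewrite -deg (bigD1 z) //= addKn.
rewrite natr_sum mulr_suml; apply: eq_bigr => y /andP[exy yz].
rewrite mul1r -dx; congr f; apply/eqP; rewrite eqn_leq dist_edge //=.
rewrite ltnNge; apply: contra yz => dy; apply/eqP.
by apply: tree_lower_neighbour_unique exy exz dy _; rewrite dx.
Qed.

End TreeLevels.

(** * The level quotient matrix and the main eigenvalues *)

Section LevelQuotient.
Variables (R : realType) (ds : seq nat).

(* Levels are indexed from 0 here; the default 1 is the degree of a leaf. *)
Definition nb_children (i : nat) : nat := (nth 1%N ds i - (i != 0))%N.

(** Entry [i], [j] counts the neighbours at level [j] of a vertex at level [i]: one parent unless
    [i] is 0, and the children. *)
Definition level_quotient : 'M[R]_((size ds).+1) :=
  \matrix_(i, j) ((i != 0 :> nat)%:R * (i.-1 == j)%:R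
                  + (nb_children i)%:R * (i.+1 == j)%:R).

Lemma level_quotientE (f : nat -> R) (i : 'I_(size ds).+1) :
  (0 < size ds)%N ->
  (level_quotient *m (\col_j f j)) i 0 =
    (i != 0 :> nat)%:R * f i.-1 + (nb_children i)%:R * f i.+1.
Proof.
move=> ds0.
have pick m : (m < (size ds).+1)%N ->
    \sum_(j < (size ds).+1) (m == j)%:R * f j = f m.
  move=> mk; rewrite (bigD1 (Ordinal mk)) //= eqxx mul1r big1 ?addr0 // => j jm.
  by rewrite eq_sym -[m]/(Ordinal mk : nat) val_eqE (negPf jm) mul0r.
rewrite mxE; under eq_bigr => j _ do rewrite !mxE mulrDl -!mulrA.
rewrite big_split /= -!mulr_sumr pick; last first.
  exact: leq_ltn_trans (leq_pred _) (ltn_ord i).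
(* In the last row [i.+1] falls outside the matrix, but leaves have no children, so the value of [f]
   there is irrelevant. *)
congr (_ + _); case: (ltnP i (size ds)) => [ik|ik]; first by rewrite pick.
have i0 : i != 0 :> nat by rewrite -lt0n (leq_trans ds0).
by rewrite /nb_children nth_default // i0 subnn !mul0r.
Qed.

Variables (n : nat) (e : rel 'I_n) (r : 'I_n).
Hypothesis bethe : gen_bethe_tree ds e r.

Local Notation A := (adjacency_matrix R e).
Local Notation B := level_quotient.
Local Notation L :=
  (\matrix_(x < n, i < (size ds).+1) (dist e r x == i)%:R : 'M[R]_(_, _)).

Let e_conn : forall x y, connect e x y. Proof. by case: bethe => _ []. Qed.

Let dist_lt (x : 'I_n) : (dist e r x < (size ds).+1)%N.
Proof. by case: bethe => _ _ /(_ x). Qed.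

Lemma bethe_degree (x : 'I_n) : degree e x = nth 1%N ds (dist e r x).
Proof.
case: bethe => _ _ _ degI degL; case: (ltnP (dist e r x) (size ds)) => dx.
  by rewrite degI ?ltnS //; apply: set_nth_default.
rewrite nth_default // degL //; congr _.+1.
by apply/eqP; rewrite eqn_leq dx -ltnS dist_lt.
Qed.

Lemma level_indicator_mul (p : nat) (M : 'M[R]_(_, p)) (x : 'I_n) (j : 'I_p) :
  (L *m M) x j = M (Ordinal (dist_lt x)) j.
Proof.
rewrite mxE (bigD1 (Ordinal (dist_lt x))) //= mxE eqxx mul1r.
rewrite big1 ?addr0 // => i.
by rewrite mxE eq_sym -val_eqE /= => /negPf ->; rewrite mul0r.
Qed.

Lemma adjacency_level_indicator : A *m L = L *m B.
Proof.
apply/matrixP => x j; rewrite level_indicator_mul !mxE /=.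
have e_tree : tree e by case: bethe.
have := tree_level_sum r e_tree (fun m => (m == j)%:R : R) x.
rewrite dist_eq0 // /nb_children dist_eq0 // bethe_degree => <-.
rewrite [RHS]big_mkcond; apply: eq_bigr => y _ /=.
by rewrite !mxE; case: (e x y); rewrite ?mul1r ?mul0r.
Qed.

Lemma level_indicator_ones : L *m (const_mx 1 : 'cV[R]_ _) = const_mx 1.
Proof. by apply/matrixP => x j; rewrite level_indicator_mul !mxE. Qed.

Lemma main_eigenvalueP (a : R) :
  main_eigenvalue e a ->
  exists2 v : 'rV[R]_n, v *m A = a *: v & v *m (const_mx 1 : 'cV[R]_n) != 0.
Proof.
case/andP => _ /rowV0Pn[u /submxP[D uE] u0]; exists (D *m eigenspace A a).
  exact/eigenspaceP/submxMl.
by rewrite -mulmxA -uE.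
Qed.

(** If [v] is a left eigenvector of [A], then [v *m L] satisfies the eigenvector equation for [B];
    it is nonzero because its entries have the same sum as those of [v]. *)
Lemma main_eigenvalue_quotient (a : R) :
  main_eigenvalue e a -> eigenvalue B a.
Proof.
case/main_eigenvalueP => v vA v1; apply/eigenvalueP; exists (v *m L).
  by rewrite -mulmxA -adjacency_level_indicator mulmxA vA -scalemxAl.
apply: contraNneq v1 => vL.
by rewrite -level_indicator_ones mulmxA vL mul0mx.
Qed.

(** Computing [v *m A *m L *m u] through [v] and through [u] gives the same multiple of
    [v *m L *m u], up to [b] times the entry sum of [v], which must therefore vanish. *)
Lemma not_main_eigenvalue (a b : R) (u : 'cV[R]_((size ds).+1)) :
  b != 0 -> B *m u = a *: u + const_mx b -> ~~ main_eigenvalue e a.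
Proof.
move=> b0 Bu; apply/negP => /main_eigenvalueP[v vA /eqP[]].
have : v *m A *m (L *m u) = v *m L *m (a *: u + const_mx b).
  by rewrite -Bu !mulmxA -(mulmxA v A) adjacency_level_indicator !mulmxA.
rewrite vA mulmxDr -scalemxAl -scalemxAr !mulmxA => /eqP.
rewrite addrC -subr_eq subrr -[b]mulr1 -scalemx_const -scalemxAr eq_sym.
by rewrite scaler_eq0 (negPf b0) -mulmxA level_indicator_ones => /eqP.
Qed.

End LevelQuotient.

(** [eigenvalue] is defined by row vectors, whereas the eigenvector for -2 is a column; singularity
    of [M - a%:M] links the two. *)
Lemma right_eigenvalue (F : fieldType) (n : nat) (M : 'M[F]_n) (a : F)
    (w : 'cV[F]_n) :
  w != 0 -> M *m w = a *: w -> eigenvalue M a.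
Proof.
move=> w0 Mw; rewrite /eigenvalue /eigenspace kermx_eq0 row_free_unit.
apply: contra w0 => Mu; rewrite -(mulKmx Mu w) mulmxBl Mw mul_scalar_mx subrr.
by rewrite mulmx0.
Qed.

Lemma size_eigenvalues (F : fieldType) (n : nat) (M : 'M[F]_n) (s : seq F) :
  uniq s -> all (eigenvalue M) s -> (size s <= n)%N.
Proof.
move=> us /allP sM; rewrite -ltnS -(size_char_poly M) max_poly_roots //.
  exact/monic_neq0/char_poly_monic.
by apply/allP => a /sM; rewrite eigenvalue_root_char.
Qed.

(** An infinite set would contain [m.+1] distinct elements; a finite one is enumerated without
    repetition. *)
Lemma card_le_uniq (T : choiceType) (S : set T) (m : nat) :
  (forall s : seq T, uniq s -> (forall x, x \in s -> S x) -> (size s <= m)%N) ->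
  (S #<= `I_m)%classic%card.
Proof.
move=> sz.
have fS : finite_set S.
  apply: contrapT => /(infinite_set_fset m.+1)[X XS].
  by rewrite ltnNge sz ?fset_uniq.
have /finite_setP[p Sp] := fS.
rewrite (card_le_eql Sp) card_le_II -(card_fset_set Sp) sz // => x.
by rewrite in_fset_set // => /set_mem.
Qed.

(** * The two level functions for -2 *)

Section Witnesses.
Variables (R : realType) (k : nat).
Hypothesis k6 : (6 <= k)%N.

Local Notation ds := ([:: 5; k - 3; 5; 3] ++ nseq (k - 5) 2)%N.

(** On the tail, [f i.-1 + f i.+1 = -2 * f i] is solved by an alternating sign times a linear
    function, chosen to vanish at [k], just past the leaves. Rows 3, 2 and 1 then force the values
    at 2, 1 and 0, and the given degrees make row 0 hold. *)
Definition bethe_eigenfun (i : nat) : R :=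
  match i with
  | 0 => - (10 * (k%:R - 4))
  | 1 => 4 * (k%:R - 4)
  | 2 => 2
  | _ => (-1) ^+ i * (k%:R - i%:R)
  end.

(** On the tail the values alternate between 0 and 1, so that [f i.-1 + 2 * f i + f i.+1 = 2]. The
    value 0 at index 2 makes row 1 independent of [k]. *)
Definition bethe_preimage (i : nat) : R :=
  match i with
  | 0 => 6
  | 1 => -2
  | _ => (odd i)%:R
  end.

Let size_ds : (size ds).+1 = k.
Proof. by rewrite size_cat size_nseq /=; lia. Qed.

Let children_tail i : (4 <= i)%N -> nb_children ds i = (i.+1 < k)%N.
Proof.
case: i => [|[|[|[|i]]]] // _; rewrite /nb_children /= nth_nseq.
by case: ifP; lia.
Qed.

Lemma level_quotient_eigenfun :
  level_quotient R ds *m (\col_i bethe_eigenfun i)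
    = (-2) *: (\col_i bethe_eigenfun i).
Proof.
apply/matrixP => i j; rewrite (ord1 j) level_quotientE // !mxE.
have : (i < k)%N by rewrite -[k in (_ < k)%N]size_ds.
have E : (k - 4)%N%:R = k%:R - 4 :> R by rewrite natrB //; lia.
case: (i : nat) => [|[|[|[|m]]]] /=.
- by move=> _; rewrite /nb_children /= subn0; ring.
- move=> _; rewrite /nb_children /= subn1 -subnS E; ring.
- by move=> _; rewrite /nb_children /= subn1 /=; ring.
- by move=> _; rewrite /nb_children /= subn1 /=; ring.
move=> mk; rewrite children_tail //.
(* The leaf row has no child term, but the formula is 0 at [k], so the tail recurrence covers it
   too. *)
have -> : ((m.+4).+1 < k)%N%:R * ((-1) ^+ m.+4.+1 * (k%:R - m.+4.+1%:R))
    = (-1) ^+ m.+4.+1 * (k%:R - m.+4.+1%:R) :> R.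
  case: ltnP => [_|km]; first by rewrite mul1r.
  have -> : k = m.+4.+1 by lia.
  by rewrite subrr !mulr0.
rewrite !exprS -!natr1; ring.
Qed.

Lemma level_quotient_preimage :
  ~~ odd k ->
  level_quotient R ds *m (\col_i bethe_preimage i)
    = (-2) *: (\col_i bethe_preimage i) + const_mx 2.
Proof.
move=> k_even; apply/matrixP => i j; rewrite (ord1 j) level_quotientE // !mxE.
have : (i < k)%N by rewrite -[k in (_ < k)%N]size_ds.
case: (i : nat) => [|[|[|[|m]]]] /=.
- by move=> _; rewrite /nb_children /= subn0; ring.
- by move=> _; rewrite /nb_children /= subn1; ring.
- by move=> _; rewrite /nb_children /= subn1 /=; ring.
- by move=> _; rewrite /nb_children /= subn1 /=; ring.
move=> mk; rewrite children_tail // !negbK.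
(* At an odd index the child term is 0 whether or not a child exists. An even index needs its child,
   and has one because the leaves sit at [k - 1], which is odd. *)
case om : (odd m) => /=; first by rewrite mulr0; ring.
have -> : (m.+4.+1 < k)%N.
  rewrite ltn_neqAle mk andbT; apply: contraNneq k_even => <-.
  by rewrite /= !negbK om.
by rewrite mulr1n; ring.
Qed.

End Witnesses.

Theorem theorem1p3 (R : realType) (k n : nat) (e : rel 'I_n) (r : 'I_n) :
  (6 <= k)%N -> ~~ odd k ->
  gen_bethe_tree ([:: 5; k - 3; 5; 3] ++ nseq (k - 5) 2)%N e r ->
  ([set a : R | main_eigenvalue e a] #<= `I_(k - 1))%classic%card.
Proof.
move=> k6 k_even bethe; apply: card_le_uniq => s us s_main.
have m2 : ~~ main_eigenvalue e (-2 : R).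
  apply: (not_main_eigenvalue bethe _ (level_quotient_preimage R k6 k_even)).
  by rewrite pnatr_eq0.
set B := level_quotient R ([:: 5; k - 3; 5; 3] ++ nseq (k - 5) 2)%N.
(* Since -2 is not main, adjoining it to [s] keeps the list free of repetitions, and [B] has at most
   [k] eigenvalues. *)
suff : (size (-2%R :: s) <=
    (size ([:: 5; k - 3; 5; 3] ++ nseq (k - 5) 2)).+1)%N.
  by rewrite size_cat size_nseq /=; lia.
apply: (@size_eigenvalues _ _ B).
  by rewrite /= us andbT; apply: contra m2 => /s_main.
apply/andP; split; last first.
  by apply/allP => a /s_main; apply: main_eigenvalue_quotient bethe _.
apply: (right_eigenvalue _ (level_quotient_eigenfun R k6)).
(* At index 2 the eigenvector has the nonzero value 2. *)
apply/eqP => /matrixP/(_ (inord 2) 0); rewrite !mxE inordK //.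
by move/eqP; rewrite pnatr_eq0.
Qed.
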